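(* Let $\mathcal{C}$ be a purely $2$-dimensional simplicial complex on a ground set $X$ with $|X| = m$, whose F-vector is $\langle 1, m, F_2\rangle$. Then $\mathrm{Rel}(\mathcal{C};q)$ has a root outside the closed unit disk $\{z\in\mathbb{C} : |z|\le 1\}$ if and only if $F_2 \in [\tfrac{m}{2}, m-2] \cup [m, 2m-5]$. If, moreover, $\mathcal{C}$ is shellable, then $\mathrm{Rel}(\mathcal{C};q)$ has a root outside the closed unit disk if and only if $F_2 \in [m, 2m-5]$.
   Context: A (simplicial) complex on a nonempty finite set $X$ is a collection of subsets of $X$ (faces) closed under taking subsets. Its dimension is the largest cardinality of a face; maximal faces are called facets; the complex is purely $d$-dimensional if all facets have cardinality exactly $d$. The F-vector is $\langle F_0,F_1,\ldots,F_d\rangle$ where $F_i$ is the number of faces of cardinality $i$. The reliability polynomial is $\mathrm{Rel}(\mathcal{C};q)=\sum_{\sigma\in\mathcal{C}} q^{|\sigma|}(1-q)^{|X\setminus\sigma|}$. For a subset $\sigma$, $\overline{\sigma}$ denotes its power set. A nonempty purely $d$-dimensional complex is shellable if its facets can be ordered $\sigma_1,\ldots,\sigma_t$ so that for each $j=2,\ldots,t$ the complex $\overline{\sigma_j}\cap\bigcup_{i<j}\overline{\sigma_i}$ is purely $(d-1)$-dimensional. *)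

(* Defs.v *)
From HB Require Import structures.
From mathcomp Require Export all_boot all_order all_algebra.
From mathcomp Require Export reals complex.

Set Implicit Arguments.
Unset Strict Implicit.
Unset Printing Implicit Defensive.

Import GRing.Theory Num.Theory.
Local Open Scope ring_scope.

Section Complexes.
Variable X : finType.
Implicit Types (C : {set {set X}}) (s t : {set X}) (d i : nat).

Definition simplicial_complex C : Prop :=
  forall s t, s \in C -> t \subset s -> t \in C.

Definition facets C : {set {set X}} := [set s | maxset [in C] s].

(* The dimension is the largest cardinality of a face (not one less). *)
Definition dim C : nat := (\max_(s in C) #|s|)%N.

Definition pure d C : Prop := forall s, s \in facets C -> #|s| = d.

Definition face_count C i : nat := #|[set s in C | #|s| == i]|.

Definition Fvector C : seq nat := mkseq (face_count C) (dim C).+1.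

(* Facets are indexed from 0.  For j > 0 the intersection contains set0, so
   its purity is never vacuous; d.-1 is only truncated when d = 0, where a
   pure complex has at most one facet and there is no condition. *)
Definition shelling d C (fs : seq {set X}) : Prop :=
  [/\ uniq fs, fs =i facets C &
      forall j, (0 < j < size fs)%N ->
        pure d.-1 (powerset (nth set0 fs j) :&:
                   \bigcup_(i < j) powerset (nth set0 fs i))].

Definition shellable d C : Prop :=
  [/\ C != set0, pure d C & exists fs, shelling d C fs].

Definition Rel (K : nzRingType) C : {poly K} :=
  \sum_(s in C) 'X^(#|s|) * (1 - 'X) ^+ #|~: s|.

End Complexes.

Definition closed_unit_disk (R : realType) : {pred R[i]} :=
  [pred z : R[i] | `|z| <= 1].

Definition has_root_outside_disk (R : realType) (p : {poly R[i]}) : Prop :=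
  exists2 z : R[i], root p z & z \notin @closed_unit_disk R.

(* Main.v *)
Require Import Defs.
From HB Require Import structures.
From mathcomp Require Import all_boot all_order all_algebra.
From mathcomp Require Import reals complex.
From mathcomp Require Import zify ring lra.

(**
Grouping faces by cardinality, [Rel(C; q) = (1 - q)^(m-2) g(q)] with
[g(q) = 1 + n q + a q^2], [n = m - 2] and [a = F2 - m + 1], so only the roots
of [g] matter.
- If [a < 0], then [g(1) = F2 > 0], and [g] has a real root between [1] and [m].
- If [a = 0], the only possible root is [-1/n].
- If [a > 0], nonreal roots have squared modulus [1/a <= 1], and the real ones
  are negative with product [1/a <= 1]; one of them is outside the disk iff
  [g(-1) = F2 - 2m + 4 < 0].
Purity forces the facets to cover [X], whence [m <= 2 F2]; along a shelling each
facet meets the union of its predecessors, so it adds at most one vertex and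
[m <= F2 + 1], which excludes [a < 0].
*)

Set Implicit Arguments.
Unset Strict Implicit.
Unset Printing Implicit Defensive.

Import Order.TTheory GRing.Theory Num.Theory.
Local Open Scope ring_scope.

(** * Face counts, covering by facets, and vertex counts along shellings *)

Section Faces.
Variable X : finType.
Implicit Types (C : {set {set X}}) (s : {set X}) (fs : seq {set X}).

Lemma Rel_face_count (K : nzRingType) C :
  Rel K C = \sum_(i < (Defs.dim C).+1)
    ('X^i * (1 - 'X) ^+ (#|X| - i)) *+ face_count C i.
Proof.
have card_dim s : s \in C -> (#|s| < (Defs.dim C).+1)%N.
  by move=> sC; rewrite ltnS /Defs.dim (bigD1 s) //= leq_maxl.
(* [inord] takes a default value out of range; [card_dim] ensures that this never happens for a
   face. *)
rewrite /Rel (partition_big (fun s => inord #|s| : 'I_(Defs.dim C).+1) predT) //=.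
apply: eq_bigr => i _; rewrite /face_count cardsE -sumr_const.
apply: eq_big => [s | s /andP[sC /eqP <-]].
  rewrite -[RHS]/((s \in C) && (#|s| == i)); case sC: (s \in C) => //=.
  by rewrite -val_eqE /= inordK // card_dim.
by rewrite inordK ?card_dim // (cardsCs (~: s)) setCK.
Qed.

Lemma face_sub_facet C s : s \in C -> exists2 t, t \in facets C & s \subset t.
Proof.
move=> sC; have [t tmax st] := @maxset_exists X [in C] s sC.
by exists t; rewrite ?inE.
Qed.

(** There are only [#|X|] singletons, so the count forces each of them to be a face, and every face
    lies in a facet. *)
Lemma cover_facets C : face_count C 1 = #|X| -> cover (facets C) = setT.
Proof.
move=> F1; apply/setP=> x; rewrite inE.
have E : [set s in C | #|s| == 1%N] = [set [set x] | x : X].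
  apply/eqP; rewrite eqEcard; apply/andP; split.
    apply/subsetP=> s; rewrite inE => /andP[_ /cards1P[y ->]].
    exact: imset_f.
  by rewrite card_imset; [rewrite -/(face_count C 1) F1 | exact: set1_inj].
have : [set x] \in [set s in C | #|s| == 1%N] by rewrite E imset_f.
rewrite inE => /andP[/face_sub_facet[t tF xt] _].
by apply/bigcupP; exists t; rewrite // -sub1set.
Qed.

Lemma card_facets C d : pure d C -> (#|facets C| <= face_count C d)%N.
Proof.
move=> Cp; apply: subset_leq_card; apply/subsetP=> s sF.
rewrite !inE (Cp _ sF) eqxx andbT.
by move: sF; rewrite inE => /maxsetp.
Qed.

(** For [d = 2] this yields the lower end [m / 2] of the first interval. *)
Lemma card_pure_complex C d :
  pure d C -> face_count C 1 = #|X| -> (#|X| <= face_count C d * d)%N.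
Proof.
move=> Cp F1; rewrite -cardsT -(cover_facets F1).
apply: leq_trans (leq_card_cover _) _.
rewrite (eq_bigr (fun=> d)) => [|s /Cp //].
by rewrite sum_nat_const leq_mul // card_facets.
Qed.

(** The intersection complex contains [set0], so it has a facet; by purity that facet has [d.-1 > 0]
    elements, and any of them is a shared vertex. *)
Lemma shelling_meets d C fs j : (1 < d)%N -> shelling d C fs ->
  (0 < j < size fs)%N ->
  exists2 x, x \in nth set0 fs j & exists i : 'I_j, x \in nth set0 fs i.
Proof.
move=> d1 [_ _ sh] /andP[j0 jfs]; have := sh j; rewrite j0 jfs => /(_ isT).
set D := _ :&: _ => Dp.
have D0 : set0 \in D.
  rewrite !inE sub0set; apply/bigcupP; exists (Ordinal j0) => //.
  by rewrite inE sub0set.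
have [t tF _] := face_sub_facet D0.
have tpos : (0 < #|t|)%N by rewrite (Dp _ tF) -subn1 subn_gt0.
have [x xt] := card_gt0P tpos.
move: tF; rewrite inE => /maxsetp; rewrite !inE => /andP[tj /bigcupP[i _]].
rewrite inE => ti; exists x; first exact: (subsetP tj).
by exists i; exact: (subsetP ti).
Qed.

(** The first edge brings two vertices; each later one shares a vertex with its predecessors and
    brings at most one more. *)
Lemma card_shelling_prefix C fs k : pure 2 C -> shelling 2 C fs ->
  (k <= size fs)%N -> (#|\bigcup_(i < k) nth set0 fs i| <= k.+1)%N.
Proof.
move=> Cp sh; elim: k => [|k IHk] kfs; first by rewrite big_ord0 cards0.
have cardk : #|nth set0 fs k| = 2%N.
  by apply: Cp; have [_ <- _] := sh; rewrite mem_nth.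
rewrite big_ord_recr /=; have [k0|k0] := posnP k.
  by move: cardk; rewrite k0 big_ord0 set0U => ->.
have [|x xk [i xi]] := @shelling_meets 2 C fs k isT sh; first by rewrite k0.
rewrite cardsU cardk.
suff : (0 < #|\bigcup_(i < k) nth set0 fs i :&: nth set0 fs k|)%N.
  move: (IHk (ltnW kfs)); set U := \bigcup_(_ < _) _ => cardU cap.
  by rewrite leq_subLR; apply: leq_trans (leq_add cardU (leqnn 2)) _; lia.
apply/card_gt0P; exists x; rewrite inE xk andbT.
by apply/bigcupP; exists i.
Qed.

Lemma card_shellable2 C :
  shellable 2 C -> face_count C 1 = #|X| -> (#|X| <= (face_count C 2).+1)%N.
Proof.
move=> [_ Cp [fs sh]] F1; have [fsU fsE _] := sh.
have fsC : size fs = #|facets C| by rewrite -(card_uniqP fsU); apply: eq_card.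
apply: (@leq_trans (size fs).+1); last by rewrite fsC ltnS card_facets.
apply: leq_trans (card_shelling_prefix Cp sh (leqnn _)).
rewrite -cardsT -(cover_facets F1); apply: subset_leq_card.
apply/subsetP=> x /bigcupP[s]; rewrite -fsE => sfs xs.
have sn : (index s fs < size fs)%N by rewrite index_mem.
by apply/bigcupP; exists (Ordinal sn); rewrite //= nth_index.
Qed.

End Faces.

(** * Location of the roots of [1 + n z + a z^2] *)

Section Quadratic.
Variable R : realType.
Implicit Types (n a x : R) (z : R[i]).

Lemma normC_le1 x y : (`|(x +i* y)%C : R[i]| <= 1) = (x ^+ 2 + y ^+ 2 <= 1).
Proof.
rewrite normc_def lecR -[X in _ <= X]sqrtr1 ler_sqrt //.
Qed.

(** The imaginary part factors, which separates real roots ([y = 0]) from nonreal ones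
    ([n = - 2 a x]). *)
Lemma quadratic_complexE n a x y :
  (1 + n%:C * (x +i* y) + a%:C * (x +i* y) ^+ 2 = 0 :> R[i])%C ->
  1 + n * x + a * (x ^+ 2 - y ^+ 2) = 0 /\ y * (n + 2 * a * x) = 0.
Proof.
rewrite expr2; simpc => -[re im]; split; first by rewrite -re; ring.
by rewrite -im; ring.
Qed.

Lemma linear_root_in_disk n z :
  n = 0 \/ 1 <= n -> 1 + n%:C%C * z = 0 -> `|z| <= 1.
Proof.
case: z => x y n01 H.
have [] := @quadratic_complexE n 0 x y; first by rewrite mul0r addr0.
rewrite normC_le1 {H}; case: n01 => [->|n1]; first by move=> re; lra.
rewrite mul0r addr0 mulr0 mul0r addr0 => re /eqP.
rewrite mulf_eq0 => /orP[]/eqP ?; last by lra.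
subst y; have x0 : x <= 0 by rewrite leNgt; apply/negP => ?; nra.
have x1 : -1 <= x by nra.
by nra.
Qed.

(** The hypothesis [n <= 1 + a] says that the quadratic is nonnegative at [-1]. *)
Lemma quadratic_root_in_disk n a z : 0 <= n -> 1 <= a -> n <= 1 + a ->
  1 + n%:C%C * z + a%:C%C * z ^+ 2 = 0 -> `|z| <= 1.
Proof.
case: z => x y n0 a1 na /quadratic_complexE[re im].
rewrite normC_le1; move/eqP: im; rewrite mulf_eq0 => /orP[]/eqP => [y0|nE].
  rewrite y0 expr0n /= addr0 in re *.
  have [x0|x0] := ltP 0 x; first by nra.
  rewrite subr0 in re.
  (* [g(x) >= (1 + x) (1 + a x)] when [x <= 0], and the latter is positive
     for [x < -1] *)
  have g_ge : (1 + x) * (1 + a * x) <= 0 by nra.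
  have [|x1] := leP (-1) x; first by nra.
  have : 0 < (- 1 - x) * (- 1 - a * x) by apply: mulr_gt0; nra.
  by nra.
have n_eq : n = - (2 * a * x) by lra.
(* Conjugate roots have product [1 / a], which is their squared modulus. *)
have : a * (x ^+ 2 + y ^+ 2) = 1 by rewrite n_eq in re; lra.
by nra.
Qed.

(** The strict bounds on the root are what later put it strictly outside the disk when one endpoint
    is [1] or [-1]. *)
Lemma quadratic_ivt n a x1 x2 : x1 <= x2 ->
  (1 + n * x1 + a * x1 ^+ 2) * (1 + n * x2 + a * x2 ^+ 2) < 0 ->
  exists2 x, x1 < x < x2 & 1 + n * x + a * x ^+ 2 = 0.
Proof.
move=> x12 sg; pose p : {poly R} := 1 + n *: 'X + a *: 'X^2.
have pE x : p.[x] = 1 + n * x + a * x ^+ 2 by rewrite /p !hornerE.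
rewrite -!pE in sg.
have [x /andP[lx xu] /rootP px] : exists2 x, x1 <= x <= x2 & root p x.
  have [p1|p1] := leP p.[x1] 0; first by apply: poly_ivt => //; nra.
  have [x xI xr] : exists2 x, x1 <= x <= x2 & root (- p) x.
    by apply: poly_ivt => //; rewrite !hornerN; nra.
  by exists x => //; rewrite -rootN.
exists x; last by rewrite -pE.
rewrite !lt_neqAle lx xu !andbT; apply/andP; split; apply/eqP => E; move: sg.
  by rewrite E px mul0r ltxx.
by rewrite -E px mulr0 ltxx.
Qed.

End Quadratic.

(** * Reduction of the reliability polynomial to the quadratic *)

Section Reliability2.
Variables (R : realType) (X : finType) (C : {set {set X}}) (m F2 : nat).
Hypothesis cardX : #|X| = m.
Hypothesis C_Fvector : Fvector C = [:: 1; m; F2]%N.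

Let n : R := m%:R - 2.
Let a : R := F2%:R - m%:R + 1.

Lemma Fvector2 :
  [/\ Defs.dim C = 2, face_count C 0 = 1, face_count C 1 = m & face_count C 2 = F2]%N.
Proof.
have dimC : Defs.dim C = 2%N.
  by move/(congr1 size): C_Fvector; rewrite size_mkseq => -[].
by move: C_Fvector; rewrite /Fvector dimC => -[-> -> ->].
Qed.

Lemma Fvector2_ge : (2 <= m)%N /\ (1 <= F2)%N.
Proof.
have [dimC F0 _ <-] := Fvector2.
have C0 : (0 < #|[set s in C]|)%N.
  apply: leq_trans (_ : face_count C 0 <= _)%N; first by rewrite F0.
  by apply: subset_leq_card; apply/subsetP=> s; rewrite !inE => /andP[].
have [s sC s2] : {s | s \in C & Defs.dim C = #|s|}.
  by apply: eq_bigmax_cond; rewrite cardsE in C0.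
split; first by rewrite -cardX -dimC s2 max_card.
by apply/card_gt0P; exists s; rewrite inE sC -s2 dimC.
Qed.

Lemma root_Rel2 (z : R[i]) : ~~ (`|z| <= 1) ->
  root (Rel R[i] C) z <-> 1 + n%:C%C * z + a%:C%C * z ^+ 2 = 0.
Proof.
move=> z1; have [m2 _] := Fvector2_ge; have [dimC F0 F1 F2E] := Fvector2.
have z_neq1 : 1 - z != 0.
  by apply: contra z1; rewrite subr_eq0 => /eqP <-; rewrite normr1.
suff E : (Rel R[i] C).[z] =
    (1 - z) ^+ (m - 2) * (1 + n%:C%C * z + a%:C%C * z ^+ 2).
  split=> [/rootP/eqP | g0]; last by apply/rootP; rewrite E g0 mulr0.
  by rewrite E mulf_eq0 expf_eq0 (negPf z_neq1) andbF => /eqP.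
(* With [m = k.+2] the exponents of [1 - z] become [k.+2], [k.+1] and [k], free of truncated
   subtraction. *)
have [k mE] : exists k, m = k.+2 by exists (m - 2)%N; lia.
have nE : n%:C%C = k%:R :> R[i].
  by rewrite -(rmorph_nat (real_complex R)) /n mE -addn2 natrD addrK.
have aE : a%:C%C = F2%:R - k.+2%:R + 1 :> R[i].
  by rewrite -mE /a rmorphD rmorphB rmorph1 !rmorph_nat.
rewrite Rel_face_count dimC !big_ord_recr big_ord0 /= F0 F1 F2E cardX nE aE.
rewrite add0r !(hornerD, hornerMn, hornerM, horner_exp, hornerN, hornerC,
  hornerX) mE !subSS !subn0 !(exprS (1 - z)).
by move: ((1 - z) ^+ k) => u; ring.
Qed.

Lemma quadratic_root_outside x : 1 < x ^+ 2 -> 1 + n * x + a * x ^+ 2 = 0 ->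
  has_root_outside_disk (Rel R[i] C).
Proof.
move=> x1 gx; exists x%:C%C.
  apply/root_Rel2; first by rewrite normC_le1 expr0n /= addr0 -ltNge.
  by rewrite -rmorphXn -!rmorphM -(rmorph1 (real_complex R)) -!rmorphD /= gx.
by rewrite inE normC_le1 expr0n /= addr0 -ltNge.
Qed.

Lemma has_root_outside_disk_Rel2 :
  has_root_outside_disk (Rel R[i] C) <->
  ((F2 + 2 <= m) \/ (m <= F2 /\ F2 + 5 <= 2 * m))%N.
Proof.
have [m2 F21] := Fvector2_ge.
have m2R : 2 <= m%:R :> R by rewrite ler_nat.
have F21R : 1 <= F2%:R :> R by rewrite ler1n.
split=> [[z rz zout] | [Fm | [mF Fm]]].
- have /root_Rel2 g0 := zout; move/g0: rz => {g0} gz.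
  have : ~~ (`|z| <= 1) by [].
  (* The three cases are the signs of [a]. *)
  case: (ltngtP F2.+1 m) => Fm; first by left; lia.
    have [|Fm2 /negP[]] := leqP (F2 + 5) (2 * m); first by right; lia.
    apply: quadratic_root_in_disk gz; rewrite /n /a.
    + by rewrite subr_ge0.
    + by have : m%:R <= F2%:R :> R; [rewrite ler_nat; lia | lra].
    + have : (2 * m)%:R <= (F2 + 4)%:R :> R by rewrite ler_nat; lia.
      by rewrite natrM natrD; lra.
  move=> /negP[]; apply: (@linear_root_in_disk _ n).
    have [m_eq2|m3] := eqVneq m 2%N; first by left; rewrite /n m_eq2 subrr.
    right; have : 3 <= m%:R :> R by rewrite ler_nat; lia.
    by rewrite /n; lra.
  move: gz; suff -> : a = 0 by rewrite mul0r addr0.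
  by rewrite /a -Fm -natr1; lra.
- have FmR : F2%:R + 2 <= m%:R :> R by rewrite -natrD ler_nat.
  (* The value at [1] is [F2 > 0]; since [a <= -1], the value at [m] is at most [1 - 2 m < 0]. *)
  have [||x /andP[x1 _] gx] := @quadratic_ivt R n a 1 m%:R; first by lra.
    have g1 : 0 < 1 + n * 1 + a * 1 ^+ 2 by rewrite /n /a; lra.
    rewrite (pmulr_rlt0 _ g1) /n /a.
    have : 0 <= (m%:R - 2 - F2%:R) * m%:R ^+ 2 :> R.
      by apply: mulr_ge0; rewrite ?sqr_ge0 //; lra.
    by lra.
  by apply: quadratic_root_outside gx; nra.
- have mFR : m%:R <= F2%:R :> R by rewrite ler_nat.
  have FmR : F2%:R + 5 <= 2 * m%:R :> R by rewrite -natrD -natrM ler_nat.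
  (* The value at [-1] is [F2 - 2 m + 4 < 0]; since [a >= 1], the value at [- m] is at least
     [1 + 2 m > 0]. *)
  have [||x /andP[_ x1] gx] := @quadratic_ivt R n a (- m%:R) (-1); first by lra.
    have g1 : 1 + n * (-1) + a * (-1) ^+ 2 < 0 by rewrite /n /a; lra.
    rewrite (nmulr_llt0 _ g1) /n /a.
    have : 0 <= (F2%:R - m%:R) * m%:R ^+ 2 :> R.
      by apply: mulr_ge0; rewrite ?sqr_ge0 //; lra.
    by lra.
  by apply: quadratic_root_outside gx; nra.
Qed.

End Reliability2.

Theorem theorem1 (R : realType) (X : finType) (C : {set {set X}}) (m F2 : nat)
  (X_neq0 : (0 < #|X|)%N)
  (cardX : #|X| = m)
  (C_complex : simplicial_complex C)
  (C_pure : pure 2 C)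
  (C_Fvector : Fvector C = [:: 1; m; F2]%N) :
  (has_root_outside_disk (Rel R[i] C) <->
     (F2%:R : R) \in `[m%:R / 2, m%:R - 2] \/
     (F2%:R : R) \in `[m%:R, 2 * m%:R - 5])
  /\
  (shellable 2 C ->
     (has_root_outside_disk (Rel R[i] C) <->
        (F2%:R : R) \in `[m%:R, 2 * m%:R - 5])).
Proof.
have [_ _ F1 F2E] := Fvector2 C_Fvector.
have F1X : face_count C 1 = #|X| by rewrite F1.
have mF : (m <= F2 * 2)%N by rewrite -cardX -F2E card_pure_complex.
have in_low : (F2%:R : R) \in `[m%:R / 2, m%:R - 2] = (F2 + 2 <= m)%N.
  rewrite in_itv /= ler_pdivrMr // -[_ * 2]natrM ler_nat mF /=.
  by rewrite lerBrDr -natrD ler_nat.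
have in_high : (F2%:R : R) \in `[m%:R, 2 * m%:R - 5] =
    (m <= F2)%N && (F2 + 5 <= 2 * m)%N.
  by rewrite in_itv /= ler_nat lerBrDr -natrD -natrM ler_nat.
rewrite in_low in_high (has_root_outside_disk_Rel2 R cardX C_Fvector).
split=> [|shC]; first by split=> -[? | /andP ?]; by [left | right].
have := card_shellable2 shC F1X; rewrite F2E cardX => mF1.
(* The bound [m <= F2 + 1] rules out the first alternative [F2 + 2 <= m]. *)
by split=> [[|/andP] | /andP] //; [lia | right].
Qed.
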